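(* \[ M_3\cap i\mathbb{R}=\{iy: y\in\mathbb{R},\ |y|\le \sqrt{32/27}\}. \]
   Context: For $c\in\mathbb{C}$, let $p_c(z):=z^3+c$ and let $p_c^{[n]}:=p_c\circ\dots\circ p_c$ ($n$ times, with $p_c^{[0]}$ the identity). The set $M_3$ is \[ M_3:=\Bigl\{c\in\mathbb{C}: \sup_{n\ge0}|p_c^{[n]}(0)|<\infty\Bigr\}. \] Here $i\mathbb{R}=\{iy:y\in\mathbb{R}\}$ is the imaginary axis. *)

(* Defs.v *)
From Stdlib Require Import Reals Ensembles.
From Coquelicot Require Import Coquelicot.

Local Open Scope C_scope.

Definition p (c z : C) : C := z ^ 3 + c.

Definition p_iter (c : C) (n : nat) : C -> C := fun z => Nat.iter n (p c) z.

(* The supremum is taken in the extended reals. *)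
Definition M3 : Ensemble C :=
  fun c => Rbar_lt (Sup_seq (fun n => Finite (Cmod (p_iter c n 0)))) p_infty.

Definition imaginary_axis : Ensemble C :=
  fun c => exists y : R, c = Ci * RtoC y.

(* Main.v *)
Require Import Defs.
From Stdlib Require Import Reals Ensembles.
From Coquelicot Require Import Coquelicot.
From Stdlib Require Import Lra Lia FunctionalExtensionality PropExtensionality.

(** On the imaginary axis the cubic map is real: [(i x)^3 + i y = i (y - x^3)],
    so membership of [i y] in [M3] asks whether the orbit of [0] under the
    decreasing map [x |-> y - x^3] is bounded.  A decreasing map is governed by
    its cycles of period two.  A pair [a <> b] with [a + b^3 = y = b + a^3]
    satisfies [a^2 + a b + b^2 = 1], and in terms of [s = a + b] this becomes
    [y = 2 s - s^3] with [s^2 <= 4/3].  The maximum of [2 s - s^3] on that range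
    is attained at [s = sqrt (2/3)] and equals [sqrt (32/27)]: this is where the
    constant comes from.

    If [|y| <= sqrt (32/27)], some [s] with [s^2 <= 2/3] solves [2 s - s^3 = y];
    the corresponding 2-cycle bounds an interval that contains [0] and is mapped
    into itself, since a decreasing map exchanging the endpoints of an interval
    preserves the interval ([real_orbit_bounded]).

    If [|y| > sqrt (32/27)], one may take [y > 0], as [x |-> - x] conjugates the
    maps for [y] and [- y].  Since [y > 1], the second iterate of [0] is
    negative, and the second iterate of the map is increasing, so the even
    iterates of [0] decrease.  If they were bounded they would converge to a
    point [t <= 0] fixed by the second iterate.  Such a [t] is not a fixed point
    of the map, as [t + t^3 <= 0 < y], and does not lie on a 2-cycle, as [y] is
    too large ([real_orbit_unbounded]). *)

Local Open Scope R_scope.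

(** * Reduction to a real map *)

Definition real_map (y x : R) : R := y - x ^ 3.

Definition real_orbit (y : R) (n : nat) : R := Nat.iter n (real_map y) 0.

Lemma p_iter_imaginary (y : R) (n : nat) :
  p_iter (Ci * RtoC y)%C n 0%C = (Ci * RtoC (real_orbit y n))%C.
Proof.
  unfold p_iter, real_orbit.
  induction n as [|n IH]; simpl.
  - ring.
  - rewrite IH; unfold p, real_map.
    generalize (Nat.iter n (fun x => y - x ^ 3) 0); intro x.
    unfold Ci, RtoC, Cmult, Cplus; simpl.
    apply injective_projections; simpl; ring.
Qed.

Lemma Cmod_p_iter_imaginary (y : R) (n : nat) :
  Cmod (p_iter (Ci * RtoC y)%C n 0%C) = Rabs (real_orbit y n).
Proof. rewrite p_iter_imaginary, Cmod_mult, Cmod_Ci, Cmod_R; ring. Qed.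

Lemma Sup_seq_lt_p_infty (u : nat -> R) :
  Rbar_lt (Sup_seq (fun n => Finite (u n))) p_infty <->
  exists B, forall n, u n <= B.
Proof.
  set (v := fun n => Finite (u n)).
  split.
  - intro H.
    assert (Hlt : forall M, Rbar_lt (Finite M) (Sup_seq v) <->
                            exists n, Rbar_lt (Finite M) (v n))
      by (intro M; apply Sup_seq_minor_lt).
    destruct (Sup_seq v) as [l | |]; try easy.
    + exists l; intro n.
      apply Rnot_lt_le; intro Hn.
      exact (Rlt_irrefl l (proj2 (Hlt l) (ex_intro _ n Hn))).
    + assert (Hn : exists n, Rbar_lt (Finite (u O - 1)) (v n))
        by (exists O; simpl; lra).
      destruct (proj2 (Hlt _) Hn).
  - intros [B HB].
    destruct (Sup_seq v) as [l | |] eqn:E; try easy.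
    destruct (proj1 (Sup_seq_minor_lt v B)) as [n Hn].
    + rewrite E; exact I.
    + simpl in Hn; specialize (HB n); lra.
Qed.

Lemma M3_imaginary (y : R) :
  M3 (Ci * RtoC y)%C <-> exists B, forall n, Rabs (real_orbit y n) <= B.
Proof.
  unfold M3.
  rewrite (Sup_seq_ext _ (fun n => Finite (Rabs (real_orbit y n)))).
  - apply Sup_seq_lt_p_infty.
  - intro n; now rewrite Cmod_p_iter_imaginary.
Qed.

Lemma real_orbit_opp (y : R) (n : nat) : real_orbit (- y) n = - real_orbit y n.
Proof.
  unfold real_orbit.
  induction n as [|n IH]; simpl.
  - ring.
  - rewrite IH; unfold real_map; ring.
Qed.

Lemma real_map_decr (y a b : R) : a <= b -> real_map y b <= real_map y a.
Proof.
  unfold real_map; intro H.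
  assert (0 <= (b - a) * ((2 * a + b) ^ 2 + 3 * b ^ 2)).
  { apply Rmult_le_pos; [lra |].
    pose proof (pow2_ge_0 (2 * a + b)); pose proof (pow2_ge_0 b); lra. }
  nra.
Qed.

(** * Cycles of period two *)

Lemma two_cycle_bound (y a b : R) :
  a <> b -> real_map y a = b -> real_map y b = a -> y ^ 2 <= 32 / 27.
Proof.
  unfold real_map; intros Hab Ha Hb.
  assert (Q : a ^ 2 + a * b + b ^ 2 = 1).
  { apply Rmult_eq_reg_l with (b - a); nra. }
  set (s := a + b).
  assert (Hq : a * b = s ^ 2 - 1) by (unfold s; nra).
  assert (Hs : s ^ 2 <= 4 / 3).
  { assert (0 <= (a - b) ^ 2) by apply pow2_ge_0. unfold s in *; nra. }
  assert (Hy : y = 2 * s - s ^ 3).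
  { assert (H2y : 2 * y = s + s ^ 3 - 3 * (a * b) * s) by (unfold s; lra).
    rewrite Hq in H2y; lra. }
  (* In [u = s^2] the bound has a double root at the maximum [u = 2/3]. *)
  assert (Hf : 32 / 27 - y ^ 2 = (s ^ 2 - 2 / 3) ^ 2 * (8 / 3 - s ^ 2))
    by (rewrite Hy; field).
  assert (0 <= (s ^ 2 - 2 / 3) ^ 2) by apply pow2_ge_0.
  nra.
Qed.

Lemma sqrt_32_27 : sqrt (32 / 27) = 4 / 3 * sqrt (2 / 3).
Proof.
  assert (0 <= sqrt (2 / 3)) by apply sqrt_pos.
  apply sqrt_lem_1; try lra.
  assert (E : sqrt (2 / 3) * sqrt (2 / 3) = 2 / 3) by (apply sqrt_sqrt; lra).
  nra.
Qed.

(** The parameters [s] and [- s] with [s = sqrt (2/3)] give the two extreme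
    values of [2 s - s^3], and the intermediate value theorem gives the rest. *)
Lemma two_cycle_parameter (y : R) :
  Rabs y <= sqrt (32 / 27) -> exists s, s ^ 2 <= 2 / 3 /\ y = 2 * s - s ^ 3.
Proof.
  rewrite sqrt_32_27; intro Hy; apply Rabs_le_between in Hy.
  assert (Hr : 0 <= sqrt (2 / 3)) by apply sqrt_pos.
  assert (E : sqrt (2 / 3) * sqrt (2 / 3) = 2 / 3) by (apply sqrt_sqrt; lra).
  set (r := sqrt (2 / 3)) in *.
  destruct (IVT_gen (fun s => 2 * s - s ^ 3) (- r) r y) as [s [Hs Hsy]].
  - intro x; apply derivable_continuous_pt; reg.
  - replace (2 * (- r) - (- r) ^ 3) with (- (4 / 3 * r)) by nra.
    replace (2 * r - r ^ 3) with (4 / 3 * r) by nra.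
    rewrite Rmin_left, Rmax_right by lra; lra.
  - rewrite Rmin_left, Rmax_right in Hs by lra.
    exists s; split; [nra | now symmetry].
Qed.

(** * Bounded and unbounded orbits *)

Lemma real_orbit_in_interval (y a b : R) :
  a <= 0 <= b -> real_map y a <= b -> a <= real_map y b ->
  forall n, a <= real_orbit y n <= b.
Proof.
  intros H0 Ha Hb n; unfold real_orbit.
  induction n as [|n IH]; simpl; [exact H0 |].
  pose proof (real_map_decr y _ _ (proj1 IH)).
  pose proof (real_map_decr y _ _ (proj2 IH)).
  lra.
Qed.

Lemma real_orbit_bounded (y : R) :
  Rabs y <= sqrt (32 / 27) -> exists B, forall n, Rabs (real_orbit y n) <= B.
Proof.
  intro Hy; destruct (two_cycle_parameter y Hy) as [s [Hs Es]].
  assert (Hd : 0 <= 4 - 3 * s ^ 2) by lra.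
  pose proof (sqrt_pos (4 - 3 * s ^ 2)) as Hp.
  pose proof (sqrt_sqrt _ Hd) as Ed.
  set (d := sqrt (4 - 3 * s ^ 2)) in *.
  (* The 2-cycle consists of the roots of [t^2 - s t + (s^2 - 1)]; their product
     is negative, so [0] lies between them. *)
  assert (Hsd : - d <= s <= d) by nra.
  assert (Ed2 : d ^ 2 = 4 - 3 * s ^ 2) by (rewrite <- Ed; ring).
  assert (Ed3 : d ^ 3 = (4 - 3 * s ^ 2) * d) by (rewrite <- Ed2; ring).
  assert (Ha : real_map y ((s - d) / 2) = (s + d) / 2).
  { unfold real_map; rewrite Es.
    replace (((s - d) / 2) ^ 3)
      with ((s ^ 3 - 3 * s ^ 2 * d + 3 * s * d ^ 2 - d ^ 3) / 8) by field.
    rewrite Ed3, Ed2; field. }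
  assert (Hb : real_map y ((s + d) / 2) = (s - d) / 2).
  { unfold real_map; rewrite Es.
    replace (((s + d) / 2) ^ 3)
      with ((s ^ 3 + 3 * s ^ 2 * d + 3 * s * d ^ 2 + d ^ 3) / 8) by field.
    rewrite Ed3, Ed2; field. }
  exists d; intro n.
  assert (Hn : (s - d) / 2 <= real_orbit y n <= (s + d) / 2)
    by (apply real_orbit_in_interval; lra).
  apply Rabs_le_between; lra.
Qed.

Lemma even_orbit_decr (y : R) :
  1 <= y ->
  forall n, real_orbit y (2 * S n) <= real_orbit y (2 * n).
Proof.
  intros Hy n.
  assert (Hstep : forall k, real_orbit y (2 * S k)
                            = real_map y (real_map y (real_orbit y (2 * k)))).
  { intro k; replace (2 * S k)%nat with (S (S (2 * k))) by lia; reflexivity. }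
  induction n as [|n IH].
  - unfold real_orbit, real_map; simpl; nra.
  - rewrite (Hstep (S n)), (Hstep n).
    do 2 apply real_map_decr.
    rewrite <- Hstep; exact IH.
Qed.

Lemma real_orbit_unbounded (y : R) :
  sqrt (32 / 27) < y -> ~ exists B, forall n, Rabs (real_orbit y n) <= B.
Proof.
  intros Hy [B HB].
  pose proof (sqrt_pos (32 / 27)) as Hp.
  assert (E : sqrt (32 / 27) * sqrt (32 / 27) = 32 / 27)
    by (apply sqrt_sqrt; lra).
  assert (Hy1 : 1 <= y) by nra.
  set (e := fun n => real_orbit y (2 * n)).
  pose proof (even_orbit_decr y Hy1) as Hdec.
  destruct (ex_finite_lim_seq_decr e (- B) Hdec) as [t Ht].
  { intro n; specialize (HB (2 * n)%nat).
    apply Rabs_le_between in HB; unfold e; lra. }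
  assert (Ht0 : t <= 0) by exact (is_lim_seq_decr_compare e t Ht Hdec O).
  assert (Hfix : real_map y (real_map y t) = t).
  { assert (Hc : is_lim_seq (fun n => real_map y (real_map y (e n)))
                            (real_map y (real_map y t))).
    { apply (is_lim_seq_continuous (fun x => real_map y (real_map y x)));
        [| exact Ht].
      unfold real_map; apply derivable_continuous_pt; reg. }
    apply is_lim_seq_incr_1 in Ht.
    apply (is_lim_seq_ext _ (fun n => real_map y (real_map y (e n)))) in Ht.
    - apply is_lim_seq_unique in Hc; apply is_lim_seq_unique in Ht.
      rewrite Hc in Ht; now injection Ht.
    - intro n; unfold e.
      replace (2 * S n)%nat with (S (S (2 * n))) by lia; reflexivity. }
  assert (Hne : t <> real_map y t).
  { unfold real_map; intro Et.
    assert (0 <= t ^ 2) by apply pow2_ge_0. nra. }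
  pose proof (two_cycle_bound y t (real_map y t) Hne eq_refl Hfix).
  nra.
Qed.

Lemma real_orbit_bounded_iff (y : R) :
  (exists B, forall n, Rabs (real_orbit y n) <= B) <->
  Rabs y <= sqrt (32 / 27).
Proof.
  split; [| apply real_orbit_bounded].
  intros [B HB]; apply Rnot_lt_le; intro Hy.
  apply (real_orbit_unbounded (Rabs y) Hy).
  exists B; intro n.
  unfold Rabs at 2; destruct (Rcase_abs y).
  - rewrite real_orbit_opp, Rabs_Ropp; apply HB.
  - apply HB.
Qed.

Theorem corollary1p2 :
  Intersection C M3 imaginary_axis =
  (fun c : C => exists y : R, c = (Ci * RtoC y)%C /\ (Rabs y <= sqrt (32 / 27))%R).
Proof.
  apply functional_extensionality; intro c.
  apply propositional_extensionality; split; intro Hc.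
  - destruct Hc as [c HM [y ->]].
    exists y; split; [reflexivity |].
    now apply real_orbit_bounded_iff, M3_imaginary.
  - destruct Hc as [y [-> Hy]].
    split.
    + now apply M3_imaginary, real_orbit_bounded_iff.
    + now exists y.
Qed.
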